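(* Assume $1<p<\infty$ and $1/p+1/q=1$, and let $\{z_0,z_1,z_2,\ldots\}$ be a sequence of distinct points in $\mathbb{D}$. There exists $K>0$ such that $$\sum_{k=0}^{\infty}(1-|z_k|^q)^{p-1}|f(z_k)|^p\le K\|f\|_p^p$$ for all $f\in\ell^p_A$, if and only if the condition (UB) holds, that is, there exists $C>0$ such that $$\Big\|\sum_{k=0}^{\infty}c_k\Lambda_{z_k}\Big\|_q\le C\Big(\sum_{k=0}^{\infty}|c_k|^q\|\Lambda_{z_k}\|_q^q\Big)^{1/q}$$ for all constants $\{c_k\}_{k=0}^{\infty}$.
   Context: $\mathbb{D}$ is the open unit disk in $\mathbb{C}$. For $1<s<\infty$, $\ell^s_A$ is the space of analytic functions $f(z)=\sum_{n\ge 0}a_nz^n$ on $\mathbb{D}$ with $\|f\|_s:=(\sum_{n\ge 0}|a_n|^s)^{1/s}<\infty$. For $w\in\mathbb{D}$, $\Lambda_w(z):=\sum_{k\ge0}w^kz^k$, which belongs to $\ell^q_A$ and has norm $\|\Lambda_w\|_q=(1-|w|^q)^{-1/q}$. A sequence of distinct points $\{z_0,z_1,z_2,\ldots\}$ in $\mathbb{D}$ satisfies the condition (UB) if there exists $C_2>0$ such that $\|c_0\Lambda_{z_0}+c_1\Lambda_{z_1}+\cdots\|_q\,\big/\,\big(|c_0|^q\|\Lambda_{z_0}\|_q^q+|c_1|^q\|\Lambda_{z_1}\|_q^q+\cdots\big)^{1/q}\le C_2$ for all sequences $(c_k)$ of complex constants, not all entries being zero. *)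

(* Defs.v *)
From HB Require Import structures.
From mathcomp Require Export all_boot all_order all_algebra.
From mathcomp Require Export all_classical all_reals all_analysis.
From mathcomp Require Export complex.
Import Order.TTheory GRing.Theory Num.Theory.
Export numFieldNormedType.Exports.

Set Implicit Arguments.
Unset Strict Implicit.
Unset Printing Implicit Defensive.

Local Open Scope classical_set_scope.
Local Open Scope ring_scope.
Local Open Scope complex_scope.

(* The topology and norm that every numFieldType carries on its regular
   module R[i]^o, transported to R[i] itself. *)
HB.instance Definition _ (R : realType) := NormedModule.copy R[i] R[i]^o.

(* A function on the unit disk is represented by a total function R[i] -> R[i];
   every notion below depends only on its values at the points of the disk. *)

Section EllA.
Context {R : realType}.
Implicit Types (s : R) (a : nat -> R[i]) (f g : R[i] -> R[i]).

(* The library norm `|x| of x : R[i] is itself an element of R[i]; this is the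
   same modulus as an element of R. *)
Definition cmod (x : R[i]) : R := complex.Re `|x|.

Definition in_disk (x : R[i]) : Prop := cmod x < 1.

Definition expansion f a : Prop :=
  forall x, in_disk x -> series (fun n => a n * x ^+ n) @ \oo --> f x.

Definition analytic_on_disk f : Prop := exists a, expansion f a.

(* An expansion on the disk is unique when it exists, so the choice made by
   xget is harmless; the value is 0 when f is not analytic on the disk. *)
Definition taylor f : nat -> R[i] := xget (fun=> 0) [set a | expansion f a].

Definition lA_norm s f : \bar R :=
  ((\sum_(0 <= n <oo) (cmod (taylor f n) `^ s)%:E) `^ s^-1)%E.

Definition lA s : set (R[i] -> R[i]) :=
  [set f | analytic_on_disk f /\ (lA_norm s f < +oo)%E].

Definition Lambda (w : R[i]) : R[i] -> R[i] :=
  fun x => limn (series (fun k => w ^+ k * x ^+ k)).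

Definition lA_has_sum s (F : nat -> R[i] -> R[i]) g : Prop :=
  lA s g /\
  lA_norm s (fun x => (\sum_(0 <= k < n) F k x) - g x) @[n --> \oo] --> 0%E.

(* The norm of the sum of the series F. The infimum is over the single value
   taken by the norm of the sum; it is over the empty set, hence +oo, when the
   series does not converge in lA s. *)
Definition lA_series_norm s (F : nat -> R[i] -> R[i]) : \bar R :=
  ereal_inf [set lA_norm s g | g in lA_has_sum s F].

Definition UB (q : R) (z : nat -> R[i]) : Prop :=
  exists2 C : R, 0 < C & forall c : nat -> R[i],
    (lA_series_norm q (fun k x => (c k * Lambda (z k) x)%R)
     <= C%:E * (\sum_(0 <= k <oo)
                  (cmod (c k) `^ q)%:E * lA_norm q (Lambda (z k)) `^ q)
               `^ q^-1)%E.

End EllA.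

(* Main.v *)
Require Import Defs.
From mathcomp Require Import ring lra.
Import Order.TTheory GRing.Theory Num.Theory.

Local Open Scope classical_set_scope.
Local Open Scope ring_scope.
Local Open Scope complex_scope.

(** Why the theorem is true: the sampling operator f |-> (f(z_k)) and the
    synthesis operator (c_k) |-> sum_k c_k Lambda_{z_k} are transposes of each
    other.  In terms of coefficients both are given by the one infinite matrix
    (z_k^n), read along its rows and along its columns, since
    f(z_k) = sum_n a_n z_k^n while the n-th coefficient of
    sum_k c_k Lambda_{z_k} is sum_k c_k z_k^n.  Writing
    w_k = 1 - |z_k|^q = ||Lambda_{z_k}||_q^-q, the two conditions say that the
    first operator is bounded from l^p to l^p(w^(p-1)), and the second from
    l^q(1/w) to l^q; these weighted spaces are dual to each other for the
    unweighted pairing.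

    The duality is needed only for finite blocks of the matrix, where it is
    Hoelder's inequality tested on the extremal vector [dual] and no
    convergence intervenes: [transpose_bound], and with the weights absorbed
    in the rows [synthesis_of_sampling] and [sampling_of_synthesis].

    What remains is to see that each condition is equivalent to a bound on
    all finite blocks that is uniform in their size.  For sampling, finite
    blocks correspond to polynomials, and a general f is recovered by letting
    the degree grow ([fatou_sum]).  For (UB), a finitely supported c has only
    one possible sum, by uniqueness of Taylor coefficients
    ([expansion0_eq0], [has_sum_norm]), so its norm is that of the finite sum.
    Conversely the bound on blocks makes the column sums converge absolutely
    ([synthesis_cvg]); applied to c with its first m entries erased it bounds
    the distance from the m-th partial sum to the limit by a power of a tail
    of a convergent series ([synthesis_tail]), which gives convergence in the
    norm of l^q_A, and the case m = 0 gives the bound itself. *)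

(** * Modulus and convergence of complex sequences *)

Section Modulus.
Context {R : realType}.
Implicit Types x y : R[i].

Lemma norm_cmod x : `|x| = (cmod x)%:C.
Proof. by rewrite /cmod normc_def. Qed.

Lemma cmod_ge0 x : 0 <= cmod x.
Proof. by rewrite /cmod normc_def /= sqrtr_ge0. Qed.

Lemma cmod0 : cmod (0 : R[i]) = 0.
Proof. by rewrite /cmod normr0. Qed.

Lemma cmodM x y : cmod (x * y) = cmod x * cmod y.
Proof. by apply: complexI; rewrite rmorphM /= -!norm_cmod normrM. Qed.

Lemma cmodX x n : cmod (x ^+ n) = cmod x ^+ n.
Proof. by apply: complexI; rewrite rmorphXn /= -!norm_cmod normrX. Qed.

Lemma cmodN x : cmod (- x) = cmod x.
Proof. by rewrite /cmod normrN. Qed.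

Lemma cmodD x y : cmod (x + y) <= cmod x + cmod y.
Proof. by rewrite -lecR rmorphD /= -!norm_cmod ler_normD. Qed.

Lemma cmod_conj x : cmod x^* = cmod x.
Proof. by rewrite /cmod normcJ. Qed.

Lemma cmod_real (r : R) : 0 <= r -> cmod r%:C = r.
Proof. by move=> r0; rewrite /cmod normc_def /= expr0n /= addr0 sqrtr_sqr ger0_norm. Qed.

Lemma cmod_eq0 x : (cmod x == 0) = (x == 0).
Proof. by rewrite -[RHS]normr_eq0 norm_cmod fmorph_eq0. Qed.

Lemma cmod_sum I (r : seq I) (P : pred I) (F : I -> R[i]) :
  cmod (\sum_(i <- r | P i) F i) <= \sum_(i <- r | P i) cmod (F i).
Proof.
elim/big_ind2 : _ => //; first by rewrite cmod0.
by move=> x1 x2 y1 y2 h1 h2; rewrite (le_trans (cmodD _ _))// lerD.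
Qed.

Lemma cmod_le_Re_Im x : cmod x <= `|complex.Re x| + `|complex.Im x|.
Proof.
rewrite /cmod normc_def /= -(@ler_pXn2r _ 2)// ?nnegrE ?sqrtr_ge0 ?addr_ge0//.
rewrite sqr_sqrtr ?addr_ge0 ?sqr_ge0// sqrrD !real_normK ?num_real//.
by rewrite addrAC lerDl mulrn_wge0// mulr_ge0.
Qed.

Lemma Re_le_cmod x : `|complex.Re x| <= cmod x.
Proof. by rewrite -lecR -norm_cmod normc_ge_Re. Qed.

Lemma Im_le_cmod x : `|complex.Im x| <= cmod x.
Proof.
rewrite /cmod normc_def /= -(@ler_pXn2r _ 2)// ?nnegrE ?sqrtr_ge0//.
by rewrite sqr_sqrtr ?addr_ge0 ?sqr_ge0// real_normK ?num_real// lerDr sqr_ge0.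
Qed.

Lemma mulc_conj x : x * x^* = ((cmod x) ^+ 2)%:C.
Proof. by rewrite -sqr_normc norm_cmod rmorphXn. Qed.

(** The topology of [R[i]] comes from a norm with values in [R[i]] itself, so
    that its radii range over the positive elements of [R[i]]; these are
    exactly the positive reals. *)
Lemma cvg_cmodP (u : nat -> R[i]) (l : R[i]) :
  u @ \oo --> l <-> (fun n => cmod (u n - l)) @ \oo --> (0 : R).
Proof.
split => [/cvgrPdist_lt ul|/cvgrPdist_lt ul].
  apply/cvgrPdist_lt => e e0; have := ul e%:C.
  rewrite ltcR => /(_ e0); apply: filterS => n.
  by rewrite distrC norm_cmod ltcR sub0r normrN ger0_norm ?cmod_ge0.
apply/cvgrPdist_lt => e; rewrite ltcE /= => /andP[/eqP e2 e1].
have -> : e = (complex.Re e)%:C by case: e e1 e2 => a b /= _ ->.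
have := ul _ e1; apply: filterS => n.
by rewrite sub0r normrN ger0_norm ?cmod_ge0// -cmodN opprB norm_cmod ltcR.
Qed.

Lemma cvg_cmod (u : nat -> R[i]) (l : R[i]) :
  u @ \oo --> l -> cmod (u n) @[n --> \oo] --> cmod l.
Proof.
move=> /cvg_cmodP ul; apply/subr_cvg0/norm_cvg0P.
apply: (@squeeze_cvgr _ _ _ _ (cst 0) (fun n => cmod (u n - l))) => //; last exact: cvg_cst.
apply: nearW => n; rewrite normr_ge0/= ler_norml lerBlDr.
have h1 := cmodD (u n - l) l; have h2 := cmodD (l - u n) (u n).
rewrite subrK in h1; rewrite subrK -opprB cmodN in h2.
by apply/andP; split; lra.
Qed.

Lemma cvg_complex (u : nat -> R[i]) (r s : R) :
  (fun n => complex.Re (u n)) @ \oo --> r -> (fun n => complex.Im (u n)) @ \oo --> s ->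
  u @ \oo --> r +i* s.
Proof.
move=> ur us; apply/cvg_cmodP.
apply: (@squeeze_cvgr _ _ _ _ (cst 0)
  (fun n => `|complex.Re (u n) - r| + `|complex.Im (u n) - s|)).
- apply: nearW => n; rewrite cmod_ge0/=.
  by have := cmod_le_Re_Im (u n - (r +i* s)); case: (u n).
- exact: cvg_cst.
- rewrite -[X in _ --> X]addr0; apply: cvgD.
    by apply/norm_cvg0P; exact/subr_cvg0.
  by apply/norm_cvg0P; exact/subr_cvg0.
Qed.

(** Proved on real and imaginary parts, whose completeness is that of [R]. *)
Lemma abs_cvg_series (u : nat -> R[i]) :
  cvgn (series (fun n => cmod (u n))) -> cvgn (series u).
Proof.
move=> cu.
have sub (v : nat -> R) : (forall n, `|v n| <= cmod (u n)) -> cvgn (series v).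
  move=> vu; apply: normed_cvg; apply: series_le_cvg cu => // n /=; rewrite ?normr_ge0 ?cmod_ge0//.
have /cvg_ex[r ur] := sub _ (fun n => Re_le_cmod (u n)).
have /cvg_ex[s us] := sub _ (fun n => Im_le_cmod (u n)).
apply/cvg_ex; exists (r +i* s); apply: cvg_complex.
  rewrite (_ : (fun _ => _) = series (fun n => complex.Re (u n)))//.
  by apply/funext => n; rewrite /series/=; apply: (big_morph (@complex.Re R)) => [[? ?] [? ?]|].
rewrite (_ : (fun _ => _) = series (fun n => complex.Im (u n)))//.
by apply/funext => n; rewrite /series/=; apply: (big_morph (@complex.Im R)) => [[? ?] [? ?]|].
Qed.

End Modulus.

(** * Hoelder duality for finite sums *)

Section Real.
Context {R : realType}.
Implicit Types (p q s x y : R).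

Lemma conjugateB1 p q : 1 < p -> p^-1 + q^-1 = 1 -> (p - 1) * q = p.
Proof.
move=> p1 pq; have q0 : q != 0.
  by apply/eqP => q0; move: pq; rewrite q0 invr0 addr0 => pE; have := invrK p; rewrite pE invr1; lra.
have p0 : p != 0 by rewrite gt_eqF// (lt_trans ltr01).
have e : p * q = q + p by rewrite -[LHS]mulr1 -pq; field; rewrite q0 p0.
by rewrite mulrBl mul1r e addrC addKr.
Qed.

Lemma conjugate_gt1 p q : 1 < p -> p^-1 + q^-1 = 1 -> 1 < q.
Proof.
move=> p1 pq; have e := conjugateB1 _ _ p1 pq.
by rewrite -(ltr_pM2l (x := p - 1)) ?subr_gt0// mulr1 e ltrBlDr ltrDl.
Qed.

Lemma powRK s x : 0 < s -> 0 <= x -> (x `^ s) `^ s^-1 = x.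
Proof. by move=> s0 x0; rewrite -powRrM divff ?gt_eqF// powRr1. Qed.

Lemma powRVK s x : 0 < s -> 0 <= x -> (x `^ s^-1) `^ s = x.
Proof. by move=> s0 x0; rewrite -powRrM mulVf ?gt_eqF// powRr1. Qed.

Lemma powR_div s x y : 0 <= x -> 0 <= y -> (x / y) `^ s = x `^ s / y `^ s.
Proof.
move=> x0 y0; rewrite powRM ?invr_ge0//; congr (_ * _).
by rewrite -powR_inv1// powRAC powR_inv1// powR_ge0.
Qed.

Lemma scaled_young p q x y (u v : R) : 0 < p -> 0 < q -> p^-1 + q^-1 = 1 ->
  0 <= x -> 0 <= y -> 0 <= u -> 0 <= v ->
  x * y / (u * v) <= x `^ p / u `^ p / p + y `^ q / v `^ q / q.
Proof.
move=> p0 q0 pq x0 y0 u0 v0.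
have := conjugate_powR (divr_ge0 x0 u0) (divr_ge0 y0 v0) p0 q0 pq.
by rewrite (powR_div p x u)// (powR_div q y v)// mulrACA -invfM.
Qed.

(** Young's inequality for each term, after scaling both vectors to norm 1. *)
Lemma hoelder_sum p q n (x y : nat -> R) :
  0 < p -> 0 < q -> p^-1 + q^-1 = 1 ->
  (forall i, 0 <= x i) -> (forall i, 0 <= y i) ->
  \sum_(0 <= i < n) x i * y i <=
  (\sum_(0 <= i < n) x i `^ p) `^ p^-1 * (\sum_(0 <= i < n) y i `^ q) `^ q^-1.
Proof.
move=> p0 q0 pq x0 y0.
have [A EA] : exists A, \sum_(0 <= i < n) x i `^ p = A by eexists.
have [B EB] : exists B, \sum_(0 <= i < n) y i `^ q = B by eexists.
have A0 : 0 <= A by rewrite -EA; apply: sumr_ge0 => i _; exact: powR_ge0.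
have B0 : 0 <= B by rewrite -EB; apply: sumr_ge0 => i _; exact: powR_ge0.
rewrite EA EB.
have zero (s : R) (v : nat -> R) : \sum_(0 <= i < n) v i `^ s = 0 ->
    forall i, (i < n)%N -> v i = 0.
  move=> /eqP; rewrite big_mkord psumr_eq0; last by move=> i _; exact: powR_ge0.
  by move=> /allP h i ni; have := h (Ordinal ni) (mem_index_enum _) => /eqP/powR_eq0_eq0.
have [AE|AN] := eqVneq A 0.
  move: EA; rewrite AE => {}EA.
  rewrite big_nat big1 ?mulr_ge0 ?powR_ge0// => i /andP[_ ni].
  by rewrite (zero _ _ EA)// mul0r.
have [BE|BN] := eqVneq B 0.
  move: EB; rewrite BE => {}EB.
  rewrite big_nat big1 ?mulr_ge0 ?powR_ge0// => i /andP[_ ni].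
  by rewrite (zero _ _ EB)// mulr0.
have a0 : 0 < A `^ p^-1 by rewrite powR_gt0// lt0r AN.
have b0 : 0 < B `^ q^-1 by rewrite powR_gt0// lt0r BN.
rewrite -[leRHS]mul1r -(ler_pdivrMr _ _ (mulr_gt0 a0 b0)) mulr_suml.
have young i : x i * y i / (A `^ p^-1 * B `^ q^-1) <=
    x i `^ p / A / p + y i `^ q / B / q.
  have := scaled_young p q _ _ _ _ p0 q0 pq (x0 i) (y0 i) (ltW a0) (ltW b0).
  by rewrite (powRVK p A p0 A0) (powRVK q B q0 B0).
apply: le_trans (ler_sum _ (fun i _ => young i)) _.
by rewrite big_split/= -!mulr_suml EA EB !divff// !mul1r pq.
Qed.

(** With [S] the quantity to bound, testing against an extremal vector gives
    an estimate with a fractional power of [S] on the right; since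
    p^-1 + q^-1 = 1, dividing by that power leaves S^(1/p) <= T^(1/p). *)
Lemma powR_absorb p q (S T : R) : 0 < p -> p^-1 + q^-1 = 1 -> 0 <= S -> 0 <= T ->
  S <= T `^ p^-1 * S `^ q^-1 -> S <= T.
Proof.
move=> p0 pq S0 T0 h; have [->//|SN] := eqVneq S 0.
have Sp : 0 < S by rewrite lt0r SN.
move: h; rewrite -{1}(powRr1 S0) -pq powRD ?SN ?implybT//.
rewrite ler_pM2r ?powR_gt0// => h.
rewrite -(powRVK _ _ p0 S0) -(powRVK _ _ p0 T0).
by rewrite ge0_ler_powR ?nnegrE ?powR_ge0// ltW.
Qed.

(** At a positive limit, [powR] is [expR] of a multiple of [ln]; at 0 it is
    small because it is increasing. *)
Lemma cvg_powR s (u : nat -> R) (l : R) : 0 < s -> (forall n, 0 <= u n) ->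
  u @ \oo --> l -> (fun n => u n `^ s) @ \oo --> l `^ s.
Proof.
move=> s0 u0 ul.
have l0 : 0 <= l.
  by rewrite -(cvg_lim _ ul)//; apply: limr_ge; [exact: cvgP ul|exact: nearW].
have [l00|lN] := eqVneq l 0; last first.
  have lp : 0 < l by rewrite lt0r lN.
  have uln : ln (u n) * s @[n --> \oo] --> ln l * s.
    apply: cvgM (cvg_cst s); exact: (continuous_cvg _ (continuous_ln lp) ul).
  have : expR (ln (u n) * s) @[n --> \oo] --> expR (ln l * s).
    exact: (continuous_cvg _ (@continuous_expR R (ln l * s)) uln).
  rewrite {2}/powR (negbTE lN) [in X in _ -> _ --> X]mulrC.
  apply: cvg_trans; apply: near_eq_cvg.
  near=> n; rewrite /powR gt_eqF 1?mulrC//; near: n.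
  exact: (cvgr_gt _ ul).
rewrite l00 powR0 ?gt_eqF//; move: ul; rewrite l00 => /cvgrPdist_lt ul.
apply/cvgrPdist_lt => e e0; have := ul (e `^ s^-1); rewrite powR_gt0// => /(_ isT).
apply: filterS => n; rewrite !sub0r !normrN !ger0_norm ?powR_ge0// => h.
by rewrite -(powRVK _ _ s0 (ltW e0)) gt0_ltr_powR ?nnegrE ?powR_ge0.
Unshelve. all: by end_near. Qed.

(** Partial sums stand for the series in all that follows: an extended
    real bound on a nonnegative series is a uniform bound on them. *)
Lemma nneseries_leP (u : nat -> R) (T : R) : (forall n, 0 <= u n) ->
  (\sum_(0 <= n <oo) (u n)%:E <= T%:E)%E <->
  forall N, \sum_(0 <= n < N) u n <= T.
Proof.
move=> u0; split => [h N|h].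
  rewrite -lee_fin (le_trans _ h)// -sumEFin.
  by apply: nneseries_lim_ge => n _ _; rewrite lee_fin.
apply: lime_le; first by apply: is_cvg_nneseries => n _ _; rewrite lee_fin.
by apply: nearW => N; rewrite sumEFin lee_fin.
Qed.

Lemma sum_truncated_le (t t' : nat -> R) M L : (forall n, 0 <= t n) ->
  (forall n, t' n = if (n < M)%N then t n else 0) ->
  \sum_(0 <= n < L) t' n <= \sum_(0 <= n < M) t n.
Proof.
move=> t0 t'E; have t'0 n : 0 <= t' n by rewrite t'E; case: ifP.
rewrite (@le_trans _ _ (\sum_(0 <= n < maxn L M) t' n))//.
  by rewrite [leRHS](big_cat_nat _ (leq_maxl L M))//= lerDl sumr_ge0.
rewrite (big_cat_nat _ (leq_maxr L M))//= -[leRHS]addr0; apply: lerD.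
  by apply: ler_sum_nat => n /andP[_ nM]; rewrite t'E nM.
by rewrite big_nat big1// => n /andP[Mn _]; rewrite t'E ltnNge Mn.
Qed.

End Real.

Section Duality.
Context {R : realType}.
Implicit Types (p q s : R) (x : R[i]).

(** The element pairing with [x] to |x|^s with modulus |x|^(s-1): the case of
    equality in Hoelder's inequality.  At x = 0 the quotient vanishes, as it
    should since s > 1. *)
Definition dual s x : R[i] := (cmod x `^ (s - 1) / cmod x)%:C * x^*.

Lemma mul_dual s x : 1 < s -> x * dual s x = (cmod x `^ s)%:C.
Proof.
move=> s1; rewrite /dual mulrCA mulc_conj -rmorphM/=; congr (_%:C).
rewrite -(@mulr_powRB1 _ _ s) ?cmod_ge0//; last by lra.
have [->|xN] := eqVneq (cmod x) 0; first by rewrite expr0n mulr0 mul0r.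
by rewrite expr2 mulrA mulfVK// mulrC.
Qed.

Lemma cmod_dual s x : 1 < s -> cmod (dual s x) = cmod x `^ (s - 1).
Proof.
move=> s1; rewrite cmodM cmod_conj cmod_real ?divr_ge0 ?powR_ge0 ?cmod_ge0//.
have [->|xN] := eqVneq (cmod x) 0; last by rewrite mulfVK.
by rewrite mulr0 powR0// subr_eq0 gt_eqF.
Qed.

(** A matrix and its transpose have the same norm between dual spaces.  To
    bound S = sum_n |b_n|^q with b the image of c under the transpose, pair b
    with its extremal vector a: then S = sum_k c_k (A a)_k, and Hoelder with
    the bound on A a gives S <= T^(1/q) (K S)^(1/p), where T = sum_k |c_k|^q,
    because sum_n |a_n|^p = S. *)
Lemma transpose_bound p q (A : nat -> nat -> R[i]) N M (K : R) :
  1 < p -> p^-1 + q^-1 = 1 -> 0 <= K ->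
  (forall a : nat -> R[i],
    \sum_(0 <= k < N) cmod (\sum_(0 <= n < M) A k n * a n) `^ p
      <= K * \sum_(0 <= n < M) cmod (a n) `^ p) ->
  forall c : nat -> R[i],
    \sum_(0 <= n < M) cmod (\sum_(0 <= k < N) A k n * c k) `^ q
      <= K `^ (q - 1) * \sum_(0 <= k < N) cmod (c k) `^ q.
Proof.
move=> p1 pq K0 bA c; have q1 := conjugate_gt1 _ _ p1 pq.
have p0 : 0 < p by lra.
have q0 : 0 < q by lra.
have qp : q^-1 + p^-1 = 1 by rewrite addrC.
have qB1 := conjugateB1 _ _ q1 qp.
set b := fun n => \sum_(0 <= k < N) A k n * c k.
set S := \sum_(0 <= n < M) _; set T := \sum_(0 <= k < N) _.
have S0 : 0 <= S by apply: sumr_ge0 => i _; exact: powR_ge0.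
have T0 : 0 <= T by apply: sumr_ge0 => i _; exact: powR_ge0.
pose a n := dual q (b n).
have aS : \sum_(0 <= n < M) cmod (a n) `^ p = S.
  by apply: eq_bigr => n _; rewrite cmod_dual// -powRrM qB1.
pose d k := \sum_(0 <= n < M) A k n * a n.
have SE : S%:C = \sum_(0 <= k < N) c k * d k.
  rewrite /S rmorph_sum /=; under eq_bigr do rewrite -mul_dual// -/(b _) -/(a _) mulr_suml.
  rewrite exchange_big/=; apply: eq_bigr => k _; rewrite mulr_sumr.
  by apply: eq_bigr => n _; rewrite mulrAC mulrC.
apply: (powR_absorb q p) => //; first by rewrite mulr_ge0 ?powR_ge0.
rewrite -{1}(cmod_real S S0) SE; apply: (le_trans (cmod_sum _ _ _ _)).
under eq_bigr do rewrite cmodM.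
apply: le_trans (hoelder_sum q p _ _ _ q0 p0 qp (fun _ => cmod_ge0 _) (fun _ => cmod_ge0 _)) _.
have KE : (K `^ (q - 1)) `^ q^-1 = K `^ p^-1.
  by rewrite -powRrM; congr (_ `^ _); rewrite mulrBl divff ?gt_eqF// mul1r; lra.
have bAa := bA a; rewrite aS in bAa.
rewrite -/T -[(K `^ (q - 1) * T)]mulrC; clearbody S T.
rewrite (powRM _ T0 (powR_ge0 _ _)) KE -mulrA -(powRM _ K0 S0).
rewrite ler_wpM2l ?powR_ge0// ge0_ler_powR ?nnegrE ?invr_ge0 ?(ltW p0)//.
  by apply: sumr_ge0 => i _; exact: powR_ge0.
by rewrite mulr_ge0.
Qed.

(** A bound on a finite block passes to the limit of its entries, each term
    being continuous; this replaces Fatou's lemma. *)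
Lemma fatou_sum (s B : R) (v : nat -> R) (u : nat -> nat -> R[i]) (l : nat -> R[i]) N :
  0 < s -> (forall k, u k @ \oo --> l k) ->
  (\forall M \near \oo, \sum_(0 <= k < N) v k * cmod (u k M) `^ s <= B) ->
  \sum_(0 <= k < N) v k * cmod (l k) `^ s <= B.
Proof.
move=> s0 ul; have cv : \sum_(0 <= k < N) v k * cmod (u k M) `^ s @[M --> \oo] -->
    \sum_(0 <= k < N) v k * cmod (l k) `^ s.
  elim: N => [|N IH]; first by rewrite big_geq//; under eq_fun do rewrite big_geq//; exact: cvg_cst.
  rewrite big_nat_recr//=; under eq_fun do rewrite big_nat_recr//=.
  apply: cvgD => //; apply: cvgM; first exact: cvg_cst.
  apply: cvg_powR => // [n|]; first exact: cmod_ge0.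
  exact: cvg_cmod.
by move=> uB; rewrite -(cvg_lim _ cv)//; apply: limr_le => //; exact: cvgP cv.
Qed.

End Duality.

(** * Power series on the disk *)

Section PowerSeries.
Context {R : realType}.
Implicit Types (s t B : R) (a b d : nat -> R[i]) (f g : R[i] -> R[i]) (x w : R[i]).

(** By definition [Lambda w] is [powser] of the powers of [w]. *)
Definition powser a x : R[i] := limn (series (fun n => a n * x ^+ n)).

Lemma powser_expansion a (M : R) : (forall n, cmod (a n) <= M) ->
  expansion (powser a) a.
Proof.
move=> aM x x1; suff : cvgn (series (fun n => a n * x ^+ n)) by [].
apply: abs_cvg_series.
have gx : cvgn (series (geometric M (cmod x))).
  by apply: is_cvg_geometric_series; rewrite ger0_norm ?cmod_ge0.
have M0 : 0 <= M by exact: le_trans (cmod_ge0 _) (aM 0%N).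
apply: series_le_cvg gx => n; first exact: cmod_ge0.
  by rewrite mulr_ge0 ?exprn_ge0 ?cmod_ge0.
by rewrite cmodM cmodX ler_wpM2r ?exprn_ge0 ?cmod_ge0.
Qed.

Lemma expansion_Lambda w : in_disk w -> expansion (Lambda w) (fun n => w ^+ n).
Proof.
move=> w1; apply: (@powser_expansion _ 1) => n.
by rewrite cmodX exprn_ile1 ?cmod_ge0// ltW.
Qed.

Lemma expansion_ext f g a b : f =1 g -> a =1 b -> expansion f a -> expansion g b.
Proof. by move=> /funext-> /funext->. Qed.

Lemma expansion_cst0 : expansion (fun=> 0 : R[i]) (fun=> 0).
Proof.
move=> x _; rewrite (_ : series _ = cst 0); first exact: cvg_cst.
by apply/funext => n; rewrite /series/= big1// => i _; rewrite mul0r.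
Qed.

Lemma expansionD f g a b : expansion f a -> expansion g b ->
  expansion (fun x => f x + g x) (fun n => a n + b n).
Proof.
move=> fa gb x x1.
rewrite (_ : series _ = series (fun n => a n * x ^+ n) \+ series (fun n => b n * x ^+ n)).
  exact: (cvgD (fa x x1) (gb x x1)).
apply/funext => n; rewrite /series/= -big_split/=.
by apply: eq_bigr => i _; rewrite mulrDl.
Qed.

Lemma expansionZ (c : R[i]) f a : expansion f a ->
  expansion (fun x => c * f x) (fun n => c * a n).
Proof.
move=> fa x x1; have /cvg_cmodP h := fa x x1; apply/cvg_cmodP.
rewrite (_ : (fun _ => _) = (fun n =>
  cmod c * cmod (series (fun n => a n * x ^+ n) n - f x))).
  by rewrite -[X in _ --> X](mulr0 (cmod c)); apply: cvgM; first exact: cvg_cst.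
apply/funext => n; rewrite -cmodM mulrBr /series/= mulr_sumr.
by under [in RHS]eq_bigr do rewrite mulrA.
Qed.

Lemma expansionB f g a b : expansion f a -> expansion g b ->
  expansion (fun x => f x - g x) (fun n => a n - b n).
Proof.
move=> fa gb; have := expansionD _ _ _ _ fa (expansionZ (-1) _ _ gb).
by apply: expansion_ext => t; rewrite mulN1r.
Qed.

Lemma expansion_sum (F : nat -> R[i] -> R[i]) (A : nat -> nat -> R[i]) N :
  (forall k, expansion (F k) (A k)) ->
  expansion (fun x => \sum_(0 <= k < N) F k x) (fun n => \sum_(0 <= k < N) A k n).
Proof.
move=> FA; elim: N => [|N IH].
  by apply: expansion_ext expansion_cst0 => t; rewrite big_geq.
have := expansionD _ _ _ _ IH (FA N).
by apply: expansion_ext => t; rewrite big_nat_recr.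
Qed.

Lemma expansion_poly a M : (forall n, (M <= n)%N -> a n = 0) ->
  expansion (fun x => \sum_(0 <= n < M) a n * x ^+ n) a.
Proof.
move=> a0 x _; apply: cvg_near_cst; exists M => // n /= Mn.
rewrite /series/= (big_cat_nat (leq0n M) Mn)/= -[RHS]addr0; congr (_ + _).
by rewrite big_nat big1// => i /andP[Mi _]; rewrite a0// mul0r.
Qed.

(** Convergence at 1/2 gives |d_n| <= B 2^n.  If the coefficients before d_m vanish, evaluating
    at a real t in ]0, 1/4[ and comparing the tail with a geometric series
    gives |d_m| t^m <= B 2 (2t)^(m+1), that is |d_m| <= B 2^(m+2) t, and t can
    be taken arbitrarily small. *)
Lemma expansion0_eq0 d : expansion (fun=> 0) d -> forall n, d n = 0.
Proof.
move=> d0.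
have [B B0 dB] : exists2 B, 0 <= B & forall n, cmod (d n) <= B * 2 ^+ n.
  have h1 : in_disk (2^-1 : R)%:C.
    by rewrite /in_disk cmod_real// invf_lt1 ?ltr1n.
  have /cvg_cmodP/cvgP/cvg_seq_bounded/bounded_fun_has_ubound[B SB] := d0 _ h1.
  set S := series _ in SB.
  have SB' n : cmod (S n) <= B by rewrite -[S n]subr0; apply: SB; exists n.
  exists (B + B); first by rewrite addr_ge0// (le_trans (cmod_ge0 (S 0%N))).
  move=> n; rewrite -ler_pdivrMr ?exprn_gt0//.
  have -> : cmod (d n) / 2 ^+ n = cmod (S n.+1 - S n).
    have -> : S n.+1 = S n + d n * (2^-1 : R)%:C ^+ n.
      by rewrite /S /series/= big_nat_recr.
    rewrite [S n + _]addrC addrK cmodM cmodX cmod_real//.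
    by rewrite exprVn.
  by rewrite (le_trans (cmodD _ _))// cmodN lerD.
elim/ltn_ind => m IH; apply/eqP; rewrite -cmod_eq0.
have key t : 0 < t -> t < 4^-1 -> cmod (d m) <= B * 2 ^+ m.+2 * t.
  move=> t0 t4; have tm : 0 < t ^+ m by rewrite exprn_gt0.
  rewrite -(ler_pM2r tm); apply/ler_addgt0Pl => e e0.
  have t1 : in_disk t%:C by rewrite /in_disk cmod_real ?ltW//; lra.
  have /cvg_cmodP/cvgrPdist_lt/(_ _ e0) := d0 _ t1.
  case=> N0 _ /(_ (maxn N0 m.+1) (leq_maxl _ _)).
  set N := maxn _ _; have mN : (m < N)%N by exact: leq_maxr.
  rewrite sub0r normrN ger0_norm ?cmod_ge0// subr0.
  set S := series _ => SN.
  have SE : S N = d m * t%:C ^+ m + \sum_(m.+1 <= i < N) d i * t%:C ^+ i.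
    rewrite /S /series/= (big_cat_nat (leq0n m) (ltnW mN))/= big_nat big1 ?add0r.
      by rewrite big_ltn.
    by move=> i /andP[_ im]; rewrite IH// mul0r.
  have -> : cmod (d m) * t ^+ m = cmod (d m * t%:C ^+ m).
    by rewrite cmodM cmodX cmod_real// ltW.
  have -> : d m * t%:C ^+ m = S N - \sum_(m.+1 <= i < N) d i * t%:C ^+ i.
    by rewrite SE addrK.
  rewrite (le_trans (cmodD _ _))// cmodN; apply: lerD; first exact: ltW.
  apply: (le_trans (cmod_sum _ _ _ _)).
  apply: (@le_trans _ _ (\sum_(m.+1 <= i < m.+1 + (N - m.+1)) B * (2 * t) ^+ i)).
    rewrite subnKC//; apply: ler_sum => i _.
    rewrite cmodM cmodX (cmod_real t (ltW t0)) exprMn mulrA.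
    by apply: ler_wpM2r (dB i); rewrite exprn_ge0// ltW.
  have -> : B * 2 ^+ m.+2 * t * t ^+ m = B * ((2 * t) ^+ m.+1 * 2).
    by rewrite !exprS exprMn; ring.
  rewrite -mulr_sumr geometric_partial_tail ler_wpM2l//.
  apply: (le_trans (@geometric_le_lim _ _ _ _ _ _ _)).
  - by rewrite exprn_ge0//; lra.
  - by lra.
  - by rewrite ger0_norm; lra.
  rewrite ler_wpM2l ?exprn_ge0//; first by lra.
  by rewrite invf_ple ?posrE; lra.
have [//|D0] := eqVneq (cmod (d m)) 0; exfalso.
have {}D0 : 0 < cmod (d m) by rewrite lt0r D0 cmod_ge0.
move: key; set D := cmod (d m) in D0 *; set A := B * 2 ^+ m.+2 => key.
have A0 : 0 <= A by rewrite mulr_ge0// exprn_ge0.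
have AD : 0 < 8 * (A + D) by lra.
(* This t is at most 1/8, and A t is at most D/8. *)
have := key (D / (8 * (A + D))); rewrite divr_gt0// => /(_ isT).
have lt4 : D / (8 * (A + D)) < 4^-1 by rewrite ltr_pdivrMr//; lra.
move=> /(_ lt4); rewrite mulrA ler_pdivlMr//.
have := mulr_gt0 D0 D0; have := mulr_ge0 A0 (ltW D0); clearbody A D; nra.
Qed.

Lemma expansion_unique f a b : expansion f a -> expansion f b -> a = b.
Proof.
move=> fa fb; apply/funext => n; apply/eqP; rewrite -subr_eq0; apply/eqP.
apply: (expansion0_eq0 (fun n => a n - b n)) => x x1.
by have := expansionB _ _ _ _ fa fb x x1; rewrite subrr.
Qed.

Lemma taylorE f a : expansion f a -> taylor f = a.
Proof. by move=> fa; apply: xget_unique => // b fb; exact: expansion_unique fb fa. Qed.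

Lemma lA_normE s f a : expansion f a ->
  lA_norm s f = ((\sum_(0 <= n <oo) (cmod (a n) `^ s)%:E) `^ s^-1)%E.
Proof. by move=> fa; rewrite /lA_norm (taylorE _ _ fa). Qed.

Lemma lA_norm_ge0 s f : (0 <= lA_norm s f)%E.
Proof. exact: poweR_ge0. Qed.

Lemma lA_norm_powE s f a : 0 < s -> expansion f a ->
  (lA_norm s f `^ s = \sum_(0 <= n <oo) (cmod (a n) `^ s)%:E)%E.
Proof.
move=> s0 fa; rewrite (lA_normE _ _ _ fa) -poweRrM mulVf ?gt_eqF// poweRe1//.
by apply: nneseries_ge0 => n _ _; rewrite lee_fin powR_ge0.
Qed.

Lemma lA_norm_leP s f a (T : R) : 0 < s -> 0 <= T -> expansion f a ->
  (lA_norm s f <= (T `^ s^-1)%:E)%E <->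
  forall M, \sum_(0 <= n < M) cmod (a n) `^ s <= T.
Proof.
move=> s0 T0 fa; rewrite -nneseries_leP; last by move=> n; exact: powR_ge0.
rewrite -(lA_norm_powE _ _ _ s0 fa).
have nn (y : \bar R) : (0 <= y)%E -> y \in `[0%E, +oo%E].
  by move=> y0; rewrite in_itv/= y0 leey.
split => h.
  rewrite -(powRVK _ _ s0 T0) -poweR_EFin.
  by apply: gt0_ler_poweR => //; rewrite ?ltW ?nn// ?lee_fin ?powR_ge0 ?lA_norm_ge0.
rewrite -[leLHS](_ : (lA_norm s f `^ s) `^ s^-1 = _)%E.
  rewrite -poweR_EFin.
  by apply: gt0_ler_poweR => //; rewrite ?invr_ge0 ?ltW ?nn// ?poweR_ge0.
by rewrite -poweRrM divff ?gt_eqF// poweRe1// lA_norm_ge0.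
Qed.

Lemma lA_norm_Lambda s w : 0 < s -> in_disk w ->
  (lA_norm s (Lambda w) `^ s)%E = ((1 - cmod w `^ s)^-1)%:E.
Proof.
move=> s0 w1; rewrite (lA_norm_powE _ _ _ s0 (expansion_Lambda _ w1)).
have ws1 : `|cmod w `^ s| < 1.
  have <- : 1 `^ s = 1 :> R by rewrite powR1.
  by rewrite ger0_norm ?powR_ge0// gt0_ltr_powR ?nnegrE ?cmod_ge0.
apply/cvg_lim => //; have h := @cvg_geometric_series R 1 _ ws1; rewrite mul1r in h.
under eq_fun do rewrite sumEFin.
apply: cvg_EFin; first exact: nearW.
apply: cvg_trans h; apply: near_eq_cvg; apply: nearW => n /=.
apply: eq_bigr => i _; rewrite /= mul1r cmodX.
by rewrite -!powR_mulrn ?cmod_ge0 ?powR_ge0// powRAC.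
Qed.

End PowerSeries.

(** * Weighted duality for finite blocks of a matrix *)

Section Sampling.
Context {R : realType}.
Variables (p q : R) (w : nat -> R) (E : nat -> nat -> R[i]).
Hypotheses (p1 : 1 < p) (pq : p^-1 + q^-1 = 1) (w_gt0 : forall k, 0 < w k).

Let q1 : 1 < q := conjugate_gt1 p q p1 pq.
Let p0 : 0 < p. Proof. exact: lt_trans ltr01 p1. Qed.
Let q0 : 0 < q. Proof. exact: lt_trans ltr01 q1. Qed.
Let qp : q^-1 + p^-1 = 1. Proof. by rewrite addrC. Qed.

(** The weights w^(p-1) here and 1/w in [synthesis_bound] are dual to each
    other because (p-1) q = p. *)
Definition sampling_bound (K : R) := forall (a : nat -> R[i]) N M,
  \sum_(0 <= k < N) w k `^ (p - 1) * cmod (\sum_(0 <= n < M) a n * E k n) `^ p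
    <= K * \sum_(0 <= n < M) cmod (a n) `^ p.

Definition synthesis_bound (D : R) := forall (c : nat -> R[i]) N M,
  \sum_(0 <= n < M) cmod (\sum_(0 <= k < N) c k * E k n) `^ q
    <= D * \sum_(0 <= k < N) cmod (c k) `^ q / w k.

(* Putting w_k^(1/q) into row k of the matrix turns both weighted bounds into
   unweighted ones: (w^(1/q))^p = w^(p-1), and c_k is replaced by
   c_k w_k^(-1/q). *)
Let A k n : R[i] := (w k `^ q^-1)%:C * E k n.

Let w_conj k : (w k `^ q^-1) `^ p = w k `^ (p - 1).
Proof.
rewrite -powRrM; congr (_ `^ _).
by rewrite -[in LHS](conjugateB1 _ _ p1 pq) mulrCA mulVf ?mulr1// gt_eqF.
Qed.

Let A_analysis (a : nat -> R[i]) M k : cmod (\sum_(0 <= n < M) A k n * a n) `^ p =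
  w k `^ (p - 1) * cmod (\sum_(0 <= n < M) a n * E k n) `^ p.
Proof.
rewrite -w_conj -powRM ?powR_ge0 ?cmod_ge0//; congr (_ `^ _).
rewrite -(cmod_real (w k `^ q^-1) (powR_ge0 _ _)) -cmodM mulr_sumr.
by congr cmod; apply: eq_bigr => n _; rewrite -mulrA [E k n * _]mulrC.
Qed.

Let A_synthesis (c : nat -> R[i]) N n : \sum_(0 <= k < N) A k n * c k =
  \sum_(0 <= k < N) (c k * (w k `^ q^-1)%:C) * E k n.
Proof. by apply: eq_bigr => k _; rewrite mulrC mulrA. Qed.

Let cmod_scaled c k : cmod (c * (w k `^ q^-1)%:C) `^ q / w k = cmod c `^ q.
Proof.
rewrite cmodM cmod_real ?powR_ge0// powRM ?cmod_ge0 ?powR_ge0//.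
by rewrite (powRVK _ _ q0 (ltW (w_gt0 k))) mulfK// gt_eqF.
Qed.

Let rescale (c : nat -> R[i]) k : c k = c k / (w k `^ q^-1)%:C * (w k `^ q^-1)%:C.
Proof. by rewrite mulfVK// fmorph_eq0 gt_eqF// powR_gt0. Qed.

Lemma synthesis_of_sampling (K : R) : 0 <= K ->
  sampling_bound K -> synthesis_bound (K `^ (q - 1)).
Proof.
move=> K0 samp c N M.
pose c' k := c k / (w k `^ q^-1)%:C.
have := transpose_bound p q A N M K p1 pq K0 _ c'.
have bA a : \sum_(0 <= k < N) cmod (\sum_(0 <= n < M) A k n * a n) `^ p
    <= K * \sum_(0 <= n < M) cmod (a n) `^ p.
  by under eq_bigr do rewrite A_analysis; exact: samp.
move=> /(_ bA); congr (_ <= _).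
  apply: eq_bigr => n _; rewrite A_synthesis; congr (cmod _ `^ _).
  by apply: eq_bigr => k _; rewrite [in RHS]rescale.
congr (_ * _); apply: eq_bigr => k _.
by rewrite [in RHS]rescale cmod_scaled.
Qed.

Lemma sampling_of_synthesis (D : R) : 0 <= D ->
  synthesis_bound D -> sampling_bound (D `^ (p - 1)).
Proof.
move=> D0 syn a N M.
have bA c : \sum_(0 <= n < M) cmod (\sum_(0 <= k < N) A k n * c k) `^ q
    <= D * \sum_(0 <= k < N) cmod (c k) `^ q.
  under eq_bigr do rewrite A_synthesis.
  have := syn (fun k => c k * (w k `^ q^-1)%:C) N M.
  by under [X in _ <= _ * X -> _]eq_bigr do rewrite cmod_scaled.
have := transpose_bound q p (fun n k => A k n) M N D q1 qp D0 bA a.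
by under eq_bigr do rewrite A_analysis.
Qed.

End Sampling.

(** * From finite blocks to the two conditions *)

Definition weight {R : realType} (q : R) (z : nat -> R[i]) (k : nat) : R :=
  1 - cmod (z k) `^ q.

Definition power_matrix {R : realType} (z : nat -> R[i]) (k n : nat) : R[i] :=
  z k ^+ n.

Section Blocks.
Context {R : realType}.
Variables (p q : R) (z : nat -> R[i]).
Hypotheses (p1 : 1 < p) (pq : p^-1 + q^-1 = 1) (zD : forall k, in_disk (z k)).

Let q1 : 1 < q := conjugate_gt1 p q p1 pq.
Let p0 : 0 < p. Proof. exact: lt_trans ltr01 p1. Qed.
Let q0 : 0 < q. Proof. exact: lt_trans ltr01 q1. Qed.

Local Notation w := (weight q z).
Local Notation E := (power_matrix z).

Lemma weight_gt0 k : 0 < w k.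
Proof.
have e : 1 `^ q = 1 :> R by rewrite powR1.
rewrite subr_gt0 -e; apply: gt0_ltr_powR => //; rewrite ?nnegrE ?cmod_ge0//.
exact: zD.
Qed.

Let term_ge0 (c : nat -> R[i]) k : 0 <= cmod (c k) `^ q / w k.
Proof. by rewrite divr_ge0 ?powR_ge0// ltW// weight_gt0. Qed.

(** Blocks of width M are the sampling inequality for polynomials of degree
    less than M. *)
Lemma sampling_bound_of_lA (K : R) : 0 <= K ->
  (forall f, lA p f -> (\sum_(0 <= k <oo) (w k `^ (p - 1) * cmod (f (z k)) `^ p)%:E
      <= K%:E * lA_norm p f `^ p)%E) ->
  sampling_bound p w E K.
Proof.
move=> K0 samp a N M; pose a' n := if (n < M)%N then a n else 0.
pose f x := \sum_(0 <= n < M) a' n * x ^+ n.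
have fa : expansion f a' by apply: expansion_poly => n; rewrite /a' ltnNge => ->.
set T := \sum_(0 <= n < M) _.
have a'T L : \sum_(0 <= n < L) cmod (a' n) `^ p <= T.
  apply: sum_truncated_le => n; first exact: powR_ge0.
  by rewrite /a'; case: ifP => // _; rewrite cmod0 powR0// gt_eqF.
have T0 : 0 <= T by apply: sumr_ge0 => n _; exact: powR_ge0.
have fp : lA p f.
  split; first by exists a'.
  by rewrite (le_lt_trans (proj2 (lA_norm_leP _ _ _ _ p0 T0 fa) a'T))// ltry.
have fT : (K%:E * lA_norm p f `^ p <= (K * T)%:E)%E.
  rewrite EFinM lee_wpmul2l ?lee_fin// (lA_norm_powE _ _ _ p0 fa).
  by apply/nneseries_leP => // n; exact: powR_ge0.
have /nneseries_leP := le_trans (samp f fp) fT.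
move=> /(_ (fun k => mulr_ge0 (powR_ge0 _ _) (powR_ge0 _ _)) N).
congr (_ <= _); apply: eq_bigr => k _; congr (_ * cmod _ `^ _).
by rewrite /f big_nat [RHS]big_nat; apply: eq_bigr => n /andP[_ nM]; rewrite /a' nM.
Qed.

Lemma lA_of_sampling_bound (K : R) : 0 <= K -> sampling_bound p w E K ->
  forall f, lA p f -> (\sum_(0 <= k <oo) (w k `^ (p - 1) * cmod (f (z k)) `^ p)%:E
      <= K%:E * lA_norm p f `^ p)%E.
Proof.
move=> K0 samp f [[a fa] foo].
have := lA_norm_ge0 p f; have := lA_norm_powE _ _ _ p0 fa.
case: (lA_norm p f) foo => // r _ rE r0.
rewrite -EFinM; apply/nneseries_leP => [k|N].
  by rewrite mulr_ge0 ?powR_ge0.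
apply: (fatou_sum p _ _ (fun k => series (fun n => a n * z k ^+ n))) => // [k|].
  exact: fa.
apply: nearW => M; apply: le_trans (samp a N M) _; rewrite ler_wpM2l//.
apply: (proj1 (nneseries_leP _ _ (fun n => powR_ge0 _ _))).
by rewrite -rE.
Qed.

(** If the series is finite its partial sums are eventually [G], so every
    sum in the sense of [lA_has_sum] is at distance 0 from [G], hence has the
    same coefficients. *)
Lemma has_sum_norm (F : nat -> R[i] -> R[i]) (G g : R[i] -> R[i])
    (b : nat -> R[i]) N : (forall k, (N <= k)%N -> F k =1 (fun=> 0)) ->
  G =1 (fun x => \sum_(0 <= k < N) F k x) -> expansion G b ->
  lA_has_sum q F g -> lA_norm q g = lA_norm q G.
Proof.
move=> F0 GE Gb [[[b' gb'] _] Fg].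
have Gg := expansionB _ _ _ _ Gb gb'.
have FG n : (N <= n)%N ->
    (fun x => \sum_(0 <= k < n) F k x - g x) = (fun x => G x - g x).
  move=> Nn; apply/funext => x; rewrite GE (big_cat_nat (leq0n N) Nn)/=.
  rewrite [\sum_(N <= k < n) _](_ : _ = 0) ?addr0//.
  by rewrite big_nat big1// => k /andP[Nk _]; rewrite F0.
have h : lA_norm q (fun x => G x - g x) = 0%E.
  apply: (cvg_unique (@ereal_hausdorff R) _ Fg).
  apply: cvg_near_cst; exists N; first exact: I.
  by move=> n Nn; exact: (congr1 (lA_norm q) (FG n Nn)).
have /(lA_norm_leP _ _ _ _ q0 (lexx 0) Gg) b0 :
    (lA_norm q (fun x => G x - g x)%R <= (0 `^ q^-1)%:E)%E.
  by rewrite h lee_fin powR_ge0.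
suff e : b = b' by rewrite (lA_normE _ _ _ gb') (lA_normE _ _ _ Gb) e.
apply/funext => n; apply/eqP; rewrite -subr_eq0 -cmod_eq0.
have := b0 n.+1; rewrite big_nat_recr//= => bn.
apply/eqP/(@powR_eq0_eq0 _ _ q); apply/eqP; rewrite eq_le powR_ge0 andbT.
by apply: le_trans bn; rewrite lerDr; apply: sumr_ge0 => i _; exact: powR_ge0.
Qed.

Lemma expansion_synthesis (c : nat -> R[i]) N :
  expansion (fun x => \sum_(0 <= k < N) c k * Lambda (z k) x)
            (fun n => \sum_(0 <= k < N) c k * z k ^+ n).
Proof.
apply: (expansion_sum (fun k x => c k * Lambda (z k) x) (fun k n => c k * z k ^+ n)).
by move=> k; apply: expansionZ; apply: expansion_Lambda.
Qed.

Lemma synthesis_weights (c : nat -> R[i]) :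
  (\sum_(0 <= k <oo) (cmod (c k) `^ q)%:E * lA_norm q (Lambda (z k)) `^ q =
   \sum_(0 <= k <oo) (cmod (c k) `^ q / w k)%:E)%E.
Proof.
apply: eq_eseriesr => k _.
by rewrite (lA_norm_Lambda _ _ q0 (zD k)).
Qed.

(** Erasing the entries of c from the N-th on leaves a finite sum, to which the
    norm appearing in (UB) necessarily refers. *)
Lemma synthesis_bound_of_UB : UB q z -> exists2 D : R, 0 <= D & synthesis_bound q w E D.
Proof.
case=> C C0 ub; exists (C `^ q); first exact: powR_ge0.
move=> c N M; set T := \sum_(0 <= k < N) _.
have T0 : 0 <= T.
  by apply: sumr_ge0.
pose c' k := if (k < N)%N then c k else 0.
have c'T : (\sum_(0 <= k <oo) (cmod (c' k) `^ q / w k)%:E <= T%:E)%E.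
  apply/nneseries_leP => // L; apply: sum_truncated_le => // k.
  by rewrite /c'; case: ifP => // _; rewrite cmod0 powR0 ?mul0r// gt_eqF.
have := ub c'; rewrite synthesis_weights => ubc.
pose G x := \sum_(0 <= k < N) c k * Lambda (z k) x.
have Gb : expansion G _ := expansion_synthesis c N.
have Gle : (lA_norm q G <= ((C `^ q * T) `^ q^-1)%:E)%E.
  apply: (@le_trans _ _ (lA_series_norm q (fun k x => c' k * Lambda (z k) x))).
    apply: le_ereal_inf_tmp => _ [g gs <-].
    rewrite (has_sum_norm _ G g _ N _ _ Gb gs)//.
      by move=> k Nk x; rewrite /c' ltnNge Nk mul0r.
    move=> x; rewrite /G big_nat [RHS]big_nat; apply: eq_bigr => k /andP[_ kN].
    by rewrite /c' kN.
  apply: (le_trans ubc); rewrite (powRM _ (powR_ge0 _ _) T0) (powRK _ _ q0 (ltW C0)).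
  rewrite EFinM lee_wpmul2l ?lee_fin ?(ltW C0)// -poweR_EFin.
  apply: gt0_ler_poweR => //; rewrite ?invr_ge0 ?(ltW q0) ?in_itv/= ?leey ?andbT//.
  by apply: nneseries_ge0 => k _ _; rewrite lee_fin.
exact: (proj1 (lA_norm_leP _ _ _ _ q0 (mulr_ge0 (powR_ge0 _ _) T0) Gb) Gle M).
Qed.

(** The first column of the matrix is constant equal to 1; the bound on
    blocks of width 1, applied to the moduli |c_k|, therefore says that the
    series of the c_k converges absolutely. *)
Lemma synthesis_cvg (c : nat -> R[i]) (D T : R) : 0 <= D -> 0 <= T ->
  synthesis_bound q w E D ->
  (forall N, \sum_(0 <= k < N) cmod (c k) `^ q / w k <= T) ->
  forall n, cvgn (series (fun k => c k * z k ^+ n)).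
Proof.
move=> D0 T0 syn cT n; apply: abs_cvg_series.
have cc : cvgn (series (fun k => cmod (c k))).
  apply: nondecreasing_is_cvgn; first by apply: nondecreasing_series => k _ _; exact: cmod_ge0.
  exists ((D * T) `^ q^-1) => _ [N _ <-].
  have := syn (fun k => (cmod (c k))%:C) N 1%N.
  rewrite big_nat1; under eq_bigr do rewrite /E expr0 mulr1.
  rewrite -rmorph_sum/= cmod_real; last by apply: sumr_ge0 => k _; exact: cmod_ge0.
  under [X in _ <= _ * X]eq_bigr do rewrite (cmod_real _ (cmod_ge0 _)).
  set S := \sum_(0 <= k < N) cmod (c k) => h.
  have S0 : 0 <= S by apply: sumr_ge0 => k _; exact: cmod_ge0.
  have {}h : S `^ q <= D * T by rewrite (le_trans h)// ler_wpM2l.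
  rewrite /series/= -/S -[leLHS](powRK _ _ q0 S0).
  by rewrite ge0_ler_powR ?nnegrE ?powR_ge0 ?mulr_ge0 ?invr_ge0 ?(ltW q0).
apply: series_le_cvg cc => k /=; rewrite ?cmod_ge0//.
rewrite cmodM cmodX ler_piMr ?cmod_ge0// exprn_ile1 ?cmod_ge0//.
exact: ltW (zD k).
Qed.

(** The bound on blocks for c with its first m entries erased, whose weighted
    norm is a tail of that of c, in the limit of infinitely many rows. *)
Lemma synthesis_tail (c : nat -> R[i]) (D T : R) : 0 <= D -> 0 <= T ->
  synthesis_bound q w E D ->
  (forall N, \sum_(0 <= k < N) cmod (c k) `^ q / w k <= T) ->
  forall m M, \sum_(0 <= n < M)
      cmod (\sum_(0 <= k < m) c k * z k ^+ n - limn (series (fun k => c k * z k ^+ n))) `^ q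
    <= D * (T - \sum_(0 <= k < m) cmod (c k) `^ q / w k).
Proof.
move=> D0 T0 syn cT m M.
pose u n N := \sum_(0 <= k < m) c k * z k ^+ n - series (fun k => c k * z k ^+ n) N.
under eq_bigr do rewrite -[cmod _ `^ _]mul1r.
apply: (fatou_sum q _ (fun=> 1) u) => // [n|].
  apply: cvgB; first exact: cvg_cst.
  exact: (synthesis_cvg c D T D0 T0 syn cT n).
exists m => // N /= mN; under eq_bigr do rewrite mul1r.
pose c' k := if (k < m)%N then 0 else c k.
have -> : \sum_(0 <= n < M) cmod (u n N) `^ q =
    \sum_(0 <= n < M) cmod (\sum_(0 <= k < N) c' k * E k n) `^ q.
  apply: eq_bigr => n _; rewrite /u /series/= -cmodN opprB; congr (cmod _ `^ _).
  rewrite (big_cat_nat (leq0n m) mN)/= addrAC subrr add0r.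
  rewrite [RHS](big_cat_nat (leq0n m) mN)/= [X in _ = X + _]big_nat.
  rewrite [X in _ = X + _]big1 ?add0r; last first.
    by move=> k /andP[_ km]; rewrite /c' km mul0r.
  by rewrite big_nat [RHS]big_nat; apply: eq_bigr => k /andP[mk _]; rewrite /c' ltnNge mk.
apply: (le_trans (syn c' N M)); rewrite ler_wpM2l// lerBrDl.
apply: le_trans (cT N); rewrite [leRHS](big_cat_nat (leq0n m) mN)/= lerD2l.
rewrite (big_cat_nat (leq0n m) mN)/= -[leRHS]add0r lerD//.
  rewrite big_nat big1// => k /andP[_ km].
  by rewrite /c' km cmod0 powR0 ?mul0r// gt_eqF.
by apply: ler_sum_nat => k /andP[mk _]; rewrite /c' ltnNge mk.
Qed.

(** When the right-hand side is finite, the candidate for the sum is the power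
    series of the column sums; [synthesis_tail] with m = 0 bounds its norm, and
    with m tending to infinity shows that the partial sums converge to it. *)
Lemma UB_of_synthesis_bound (D : R) : 0 < D -> synthesis_bound q w E D -> UB q z.
Proof.
move=> D0 syn; exists (D `^ q^-1); first exact: powR_gt0.
move=> c; rewrite synthesis_weights.
have g0 := term_ge0 c.
have [foo|] := ltP (\sum_(0 <= k <oo) (cmod (c k) `^ q / w k)%:E)%E +oo%E; last first.
  rewrite leye_eq => /eqP ->; rewrite poweRyr ?invr_eq0 ?gt_eqF//.
  by rewrite gt0_muley ?lte_fin ?powR_gt0// leey.
have cvs := nnseries_is_cvg g0 foo.
set T := limn (series (fun k => cmod (c k) `^ q / w k)).
have TE : (\sum_(0 <= k <oo) (cmod (c k) `^ q / w k)%:E = T%:E)%E.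
  by rewrite -(EFin_lim cvs); apply: congr_lim; apply/funext => N /=; rewrite sumEFin.
have cT : forall N, \sum_(0 <= k < N) cmod (c k) `^ q / w k <= T.
  by apply: (proj1 (nneseries_leP _ _ g0)); rewrite TE.
have T0 : 0 <= T by have := cT 0%N; rewrite big_geq.
have tail := synthesis_tail c D T (ltW D0) T0 syn cT.
pose B n := limn (series (fun k => c k * z k ^+ n)).
have DT0 : 0 <= D * T by rewrite mulr_ge0// ltW.
have BT M : \sum_(0 <= n < M) cmod (B n) `^ q <= D * T.
  have := tail 0%N M; rewrite [X in _ - X]big_geq// subr0; congr (_ <= _).
  by apply: eq_bigr => n _; rewrite big_geq// sub0r cmodN.
have gB : expansion (powser B) B.
  apply: (powser_expansion _ ((D * T) `^ q^-1)) => n.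
  rewrite -[leLHS](powRK _ _ q0 (cmod_ge0 _)).
  rewrite ge0_ler_powR ?nnegrE ?powR_ge0 ?invr_ge0 ?(ltW q0)//.
  apply: le_trans (BT n.+1); rewrite big_nat_recr//= lerDr.
  by apply: sumr_ge0 => i _; exact: powR_ge0.
have gle : (lA_norm q (powser B) <= ((D * T) `^ q^-1)%:E)%E.
  exact/(lA_norm_leP _ _ _ _ q0 DT0 gB).
rewrite TE poweR_EFin -EFinM -(powRM _ (ltW D0) T0).
apply: (le_trans _ gle); apply: ereal_inf_lbound; exists (powser B) => //; split.
  split; first by exists B.
  by rewrite (le_lt_trans gle)// ltry.
pose e n := (D * (T - series (fun k => cmod (c k) `^ q / w k) n)) `^ q^-1.
have e0 : (e n)%:E @[n --> \oo] --> 0%E.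
  apply: cvg_EFin; first exact: nearW.
  have -> : 0 = (D * (T - T)) `^ q^-1 by rewrite subrr mulr0 powR0// invr_eq0 gt_eqF.
  apply: cvg_powR; first by rewrite invr_gt0.
    by move=> n; rewrite mulr_ge0 ?(ltW D0)// subr_ge0 cT.
  by apply: cvgM; [exact: cvg_cst|apply: cvgB => //; exact: cvg_cst].
apply: (squeeze_cvge _ (cvg_cst 0%E) e0); apply: nearW => n /=.
rewrite lA_norm_ge0/=.
apply/(lA_norm_leP _ _ _ _ q0 _ (expansionB _ _ _ _ (expansion_synthesis c n) gB)) => //.
by rewrite mulr_ge0 ?(ltW D0)// subr_ge0 cT.
Qed.

End Blocks.

Theorem theorem7p1 (R : realType) (p q : R) (z : nat -> R[i])
  (hp : 1 < p) (hpq : p^-1 + q^-1 = 1)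
  (hz : forall k, in_disk (z k)) (zinj : injective z) :
  (exists2 K : R, 0 < K & forall f : R[i] -> R[i], lA p f ->
     (\sum_(0 <= k <oo)
        ((1 - cmod (z k) `^ q) `^ (p - 1) * cmod (f (z k)) `^ p)%:E
      <= K%:E * lA_norm p f `^ p)%E)
  <-> UB q z.
Proof.
have w0 := weight_gt0 p q z hp hpq hz.
split => [[K K0 samp]|ub].
  have samp' := sampling_bound_of_lA p q z hp K (ltW K0) samp.
  have syn := synthesis_of_sampling p q _ _ hp hpq w0 K (ltW K0) samp'.
  by apply: (UB_of_synthesis_bound p q z hp hpq hz _ _ syn); exact: powR_gt0.
have [D D0 syn] := synthesis_bound_of_UB p q z hp hpq hz ub.
have samp := sampling_of_synthesis p q _ _ hp hpq w0 D D0 syn.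
(* D may vanish, whereas the constant asked for is positive. *)
exists (D `^ (p - 1) + 1); first by rewrite ltr_wpDl// powR_ge0.
move=> f fp; apply: (le_trans
  (lA_of_sampling_bound p q z hp hz _ (powR_ge0 _ _) samp f fp)).
by rewrite lee_wpmul2r ?poweR_ge0// lee_fin lerDl.
Qed.
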